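(* Let $0\le p_1\le p_2\le p_3\le p_4\le 1$, $\tilde p=(p_1,p_2,p_3,p_4)$. For any $\beta\in[0,1]$, the function $$F_{\tilde p,\beta}(x)=\frac12H(x)+(1-\beta)\big(J(x)-H(x)\big),\qquad x\in\mathbb{R},$$ with $H,J$ as defined in the context, satisfies the properties of the cumulative distribution function of a random variable: it is non-negative, non-decreasing, tends to $0$ at $-\infty$, and tends to $1$ at $+\infty$.
   Context: For $i=1,2$, $F_i$ is the cumulative distribution function of the normal distribution with mean $\mu_i\in\mathbb{R}$ and standard deviation $\sigma_i>0$. Constants: $P_1=\frac{p_1p_3}{3}+\frac{2p_2p_3}{3}+\frac{2p_1p_4}{3}+\frac{p_2p_4}{3}$, $P_2=\frac{p_1+p_2+p_3+p_4}{2}-\frac{p_1p_3}{3}-\frac{2p_1p_4}{3}-\frac{2p_2p_3}{3}-\frac{p_2p_4}{3}$, $P_3=2-(p_1+p_2+p_3+p_4)+\frac{p_1p_3}{3}+\frac{2p_1p_4}{3}+\frac{2p_2p_3}{3}+\frac{p_2p_4}{3}$. Functions: $H(x)=P_1F_1(x)^2+2P_2F_1(x)F_2(x)+P_3F_2(x)^2$, $J(x)=P_1F_1(x)+P_2(F_1(x)+F_2(x))+P_3F_2(x)$. *)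

(* Defs.v *)
From HB Require Import structures.
From mathcomp Require Import all_boot all_order all_algebra.
From mathcomp Require Import all_classical all_reals all_analysis.
Import Order.TTheory GRing.Theory Num.Theory numFieldNormedType.Exports.

Set Implicit Arguments.
Unset Strict Implicit.
Unset Printing Implicit Defensive.

Local Open Scope ring_scope.

Definition idRV (R : realType) : measurableTypeR R -> R := idfun.

HB.instance Definition _ (R : realType) :=
  @isMeasurableFun.Build _ _ _ _ (@idRV R) (@measurable_id _ _ setT).

(* Under [normal_prob m s], [idRV] is normally distributed with mean m and,
   for 0 < s, standard deviation (not variance) s.  A cdf takes values in
   [0, 1], so [fine] loses nothing. *)
Definition normal_cdf (R : realType) (m s x : R) : R :=
  fine (cdf (@idRV R : {RV (normal_prob m s) >-> R}) x).

Section mixture.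
Variable R : realType.
Implicit Types (p b x : R) (F : R -> R).

Definition P1 p1 p2 p3 p4 : R :=
  p1 * p3 / 3 + 2 * p2 * p3 / 3 + 2 * p1 * p4 / 3 + p2 * p4 / 3.

Definition P2 p1 p2 p3 p4 : R :=
  (p1 + p2 + p3 + p4) / 2 - p1 * p3 / 3 - 2 * p1 * p4 / 3
  - 2 * p2 * p3 / 3 - p2 * p4 / 3.

Definition P3 p1 p2 p3 p4 : R :=
  2 - (p1 + p2 + p3 + p4) + p1 * p3 / 3 + 2 * p1 * p4 / 3
  + 2 * p2 * p3 / 3 + p2 * p4 / 3.

Definition Hmix p1 p2 p3 p4 F1 F2 x : R :=
  P1 p1 p2 p3 p4 * F1 x ^+ 2 + 2 * P2 p1 p2 p3 p4 * F1 x * F2 x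
  + P3 p1 p2 p3 p4 * F2 x ^+ 2.

Definition Jmix p1 p2 p3 p4 F1 F2 x : R :=
  P1 p1 p2 p3 p4 * F1 x + P2 p1 p2 p3 p4 * (F1 x + F2 x)
  + P3 p1 p2 p3 p4 * F2 x.

Definition Fmix p1 p2 p3 p4 b F1 F2 x : R :=
  1 / 2 * Hmix p1 p2 p3 p4 F1 F2 x
  + (1 - b) * (Jmix p1 p2 p3 p4 F1 F2 x - Hmix p1 p2 p3 p4 F1 F2 x).

End mixture.

(* Main.v *)
Require Import Defs.
From HB Require Import structures.
From mathcomp Require Import all_boot all_order all_algebra.
From mathcomp Require Import all_classical all_reals all_analysis.
From mathcomp Require Import ring lra.
Import Order.TTheory GRing.Theory Num.Theory numFieldNormedType.Exports.

Local Open Scope classical_set_scope.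
Local Open Scope ring_scope.

(* The mixture is a nonnegative combination of the functions
   [kernel (1 - b) (F i x) (F j x)], where [kernel c u v] interpolates between
   [u * v / 2] at [c = 0] and [(1 - (1 - u) * (1 - v)) / 2] at [c = 1]; both
   are nondecreasing in [u] and [v] on the unit square. The coefficients
   [P1], [2 * P2], [P3] are nonnegative because [x * y <= (x + y) / 2] on the
   unit square and because [P3] is [P1] evaluated at the [1 - p i]. *)

Definition kernel {R : realType} (c u v : R) : R :=
  u * v / 2 + c * ((u + v) / 2 - u * v).

(** [Hmix] collects the products [F i x * F j x] and [Jmix] the means [(F i x + F j x) / 2], with
    the same weights [P1], [2 * P2], [P3]. *)
Lemma FmixE (R : realType) (p1 p2 p3 p4 b : R) (F1 F2 : R -> R) (x : R) :
  Fmix p1 p2 p3 p4 b F1 F2 x =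
    P1 p1 p2 p3 p4 * kernel (1 - b) (F1 x) (F1 x)
    + 2 * P2 p1 p2 p3 p4 * kernel (1 - b) (F1 x) (F2 x)
    + P3 p1 p2 p3 p4 * kernel (1 - b) (F2 x) (F2 x).
Proof. by rewrite /Fmix /Hmix /Jmix /kernel; field. Qed.

Lemma kernel00 (R : realType) (c : R) : kernel c 0 0 = 0.
Proof. by rewrite /kernel; field. Qed.

Lemma kernel11 (R : realType) (c : R) : kernel c 1 1 = 1 / 2.
Proof. by rewrite /kernel; field. Qed.

Lemma le_kernel (R : realType) (c u v u' v' : R) : 0 <= c <= 1 ->
  0 <= u -> u <= u' -> u' <= 1 -> 0 <= v -> v <= v' -> v' <= 1 ->
  kernel c u v <= kernel c u' v'.
Proof.
move=> /andP[c0 c1] u0 uu' u1 v0 vv' v1; rewrite -subr_ge0.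
(* Here [kernel c u v] is read as [(1 - c) / 2 * (u * v) + c / 2 * (u + v - u * v)]. The increment
   of each part is telescoped, changing [u] first and then [v], so that every factor is nonnegative
   on the unit square. *)
have -> : kernel c u' v' - kernel c u v =
    (1 - c) / 2 * ((u' - u) * v' + u * (v' - v))
  + c / 2 * ((u' - u) * (1 - v) + (1 - u') * (v' - v)).
  by rewrite /kernel; field.
by apply: addr_ge0; apply: mulr_ge0; rewrite ?divr_ge0//;
  try (apply: addr_ge0; apply: mulr_ge0); lra.
Qed.

Lemma kernel_ge0 (R : realType) (c u v : R) : 0 <= c <= 1 ->
  0 <= u <= 1 -> 0 <= v <= 1 -> 0 <= kernel c u v.
Proof.
move=> c01 /andP[u0 u1] /andP[v0 v1].
by rewrite -(kernel00 _ c) le_kernel.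
Qed.

(** The filter is arbitrary so that both ends of the real line are covered. *)
Lemma cvg_kernel (R : realType) (T : Type) (A : set_system T) (c l k : R)
    (f g : T -> R) : Filter A -> f @ A --> l -> g @ A --> k ->
  kernel c (f x) (g x) @[x --> A] --> kernel c l k.
Proof.
move=> FA fl gk; have fg : f x * g x @[x --> A] --> l * k by exact: cvgM.
apply: cvgD; first exact: cvgMr_tmp.
apply: cvgMl_tmp; apply: cvgB => //.
by apply: cvgMr_tmp; exact: cvgD.
Qed.

Section weights.
Variables (R : realType) (p1 p2 p3 p4 : R).

(** The total 2 compensates the value [1 / 2] of the kernel at [(1, 1)], which makes the limit at
    [+oo] equal to 1. *)
Lemma weights_sum :
  P1 p1 p2 p3 p4 + 2 * P2 p1 p2 p3 p4 + P3 p1 p2 p3 p4 = 2.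
Proof. by rewrite /P1 /P2 /P3; field. Qed.

Lemma P1_ge0 : 0 <= p1 -> 0 <= p2 -> 0 <= p3 -> 0 <= p4 ->
  0 <= P1 p1 p2 p3 p4.
Proof.
by move=> *; rewrite /P1; repeat apply: addr_ge0; apply: divr_ge0;
  rewrite ?mulr_ge0.
Qed.

Lemma P2_ge0 : 0 <= p1 <= 1 -> 0 <= p2 <= 1 -> 0 <= p3 <= 1 -> 0 <= p4 <= 1 ->
  0 <= P2 p1 p2 p3 p4.
Proof.
move=> p1_01 p2_01 p3_01 p4_01.
have le_mean (x y : R) : 0 <= x <= 1 -> 0 <= y <= 1 -> x * y <= (x + y) / 2.
  by move=> ? ?; nra.
(* [P2] is the sum of the gaps [(x + y) / 2 - x * y] over these four pairs, with weight 1/3 for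
   [(p1, p3)] and [(p2, p4)] and 2/3 for the other two; each [p i] thus receives total weight 1. *)
have := le_mean _ _ p1_01 p3_01; have := le_mean _ _ p1_01 p4_01.
have := le_mean _ _ p2_01 p3_01; have := le_mean _ _ p2_01 p4_01.
by rewrite /P2; lra.
Qed.

Lemma P3E : P3 p1 p2 p3 p4 = P1 (1 - p1) (1 - p2) (1 - p3) (1 - p4).
Proof. by rewrite /P3 /P1; field. Qed.

End weights.

Section normal_cdf.
Variables (R : realType) (m s : R).
Let X : {RV (normal_prob m s) >-> R} := @idRV R.

Let cdf_fin_num x : cdf X x \is a fin_num.
Proof. by rewrite fin_num_measure. Qed.

Lemma normal_cdf_01 x : 0 <= normal_cdf m s x <= 1.
Proof.
apply/andP; split; first by rewrite fine_ge0// cdf_ge0.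
rewrite -lee_fin fineK; [exact: (cdf_le1 X) | exact: cdf_fin_num].
Qed.

Lemma normal_cdf_homo : {homo normal_cdf m s : x y / x <= y}.
Proof. by move=> x y xy; apply: fine_le; [exact: cdf_fin_num..|exact: cdf_nondecreasing]. Qed.

Lemma cvg_normal_cdfNy : normal_cdf m s x @[x --> -oo] --> (0 : R).
Proof. exact/fine_cvg/(cvg_cdfNy0 X). Qed.

Lemma cvg_normal_cdfy : normal_cdf m s x @[x --> +oo] --> (1 : R).
Proof. exact/fine_cvg/(cvg_cdfy1 X). Qed.

End normal_cdf.

Theorem proposition4p1 (R : realType) (m1 m2 s1 s2 : R)
  (s1_gt0 : 0 < s1) (s2_gt0 : 0 < s2)
  (p1 p2 p3 p4 : R)
  (p1_ge0 : 0 <= p1) (p12 : p1 <= p2) (p23 : p2 <= p3) (p34 : p3 <= p4)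
  (p4_le1 : p4 <= 1)
  (b : R) (b_ge0 : 0 <= b) (b_le1 : b <= 1) :
  let F : R -> R :=
    Fmix p1 p2 p3 p4 b (normal_cdf m1 s1) (normal_cdf m2 s2) in
  [/\ forall x : R, 0 <= F x,
      {homo F : x y / x <= y},
      F x @[x --> -oo] --> (0 : R)
    & F x @[x --> +oo] --> (1 : R)].
Proof.
move=> F.
have c01 : 0 <= 1 - b <= 1 by lra.
have P1ge0 : 0 <= P1 p1 p2 p3 p4 by apply: P1_ge0; lra.
have P2ge0 : 0 <= 2 * P2 p1 p2 p3 p4.
  by apply: mulr_ge0 => //; apply: P2_ge0; lra.
have P3ge0 : 0 <= P3 p1 p2 p3 p4 by rewrite P3E; apply: P1_ge0; lra.
have cvgF (A : set_system R) (l : R) : Filter A ->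
    normal_cdf m1 s1 @ A --> l -> normal_cdf m2 s2 @ A --> l ->
    F x @[x --> A] --> 2 * kernel (1 - b) l l.
  (* Expanding the factor 2 as the sum of the weights matches the limit term by term with
     [FmixE]. *)
  move=> FA F1l F2l; rewrite -(weights_sum _ p1 p2 p3 p4) 2!mulrDl.
  under eq_fun do rewrite /F FmixE.
  by apply: cvgD; [apply: cvgD|]; apply: cvgMl_tmp; exact: cvg_kernel.
split.
- move=> x; rewrite /F FmixE.
  by repeat apply: addr_ge0; apply: mulr_ge0 => //; apply: kernel_ge0 => //;
    exact: normal_cdf_01.
- move=> x y xy; rewrite /F !FmixE.
  have /andP[? _] := normal_cdf_01 _ m1 s1 x.
  have /andP[_ ?] := normal_cdf_01 _ m1 s1 y.
  have /andP[? _] := normal_cdf_01 _ m2 s2 x.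
  have /andP[_ ?] := normal_cdf_01 _ m2 s2 y.
  have ? := normal_cdf_homo _ m1 s1 _ _ xy.
  have ? := normal_cdf_homo _ m2 s2 _ _ xy.
  by repeat apply: lerD; apply: ler_wpM2l => //; exact: le_kernel.
- rewrite (_ : 0 = 2 * kernel (1 - b) 0 0); last by rewrite kernel00 mulr0.
  by apply: cvgF; exact: cvg_normal_cdfNy.
- rewrite (_ : 1 = 2 * kernel (1 - b) 1 1); last by rewrite kernel11; field.
  by apply: cvgF; exact: cvg_normal_cdfy.
Qed.
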